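(* Let $C_0 \approx 13.901$ be the constant described in the context. Then, as $t \to \infty$, \[R_2(2,t) = O\big(t\, 6^{t/4}\big) \qquad\text{and}\qquad R_3(2,t) = O\big(t\, C_0^{t}\big).\]
   Context: For a finite field $\mathbb F_q$ and positive integers $s,t$, $R_q(s,t)$ denotes the minimum $n$ such that for every red-blue coloring of the $1$-dimensional linear subspaces of $\mathbb F_q^n$, there is either a linear subspace of dimension $s$ all of whose $1$-dimensional subspaces are red, or a linear subspace of dimension $t$ all of whose $1$-dimensional subspaces are blue. The constant $C_0 \approx 13.901$ is the absolute constant $C_0 = 1 + 1/(1-\log_3 \gamma)$ with $\gamma = \min_{0<x<1}(1+x+x^2)/x^{2/3} \approx 2.7552$ (the constant of Fox–Pham's theorem on affine subspaces in dense subsets of $\mathbb F_3^n$); it has the known property that every $A \subseteq \mathbb F_3^n$ with $|A| = \alpha 3^n$ contains at least $\alpha^{C_0} 3^{2n}$ triples of the form $(x, x+d, x+2d)$ with $x,d \in \mathbb F_3^n$. *)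

(* Defs.v *)
From HB Require Import structures.
From mathcomp Require Import all_boot all_order all_algebra all_field.
From mathcomp Require Import all_classical all_reals all_analysis.
Set Implicit Arguments. Unset Strict Implicit. Unset Printing Implicit Defensive.
Import Order.TTheory GRing.Theory Num.Theory.
Local Open Scope ring_scope.
Local Open Scope classical_set_scope.

(* A red-blue colouring of the 1-dimensional subspaces of F^n is a function
   on subspaces (canonically represented by square matrices <<A>>%MS),
   only evaluated on lines <<v>>%MS with v <> 0.  true = red, false = blue. *)

Definition mono_subspace (F : finFieldType) (n d : nat)
  (c : 'M[F]_n -> bool) (b : bool) (A : 'M[F]_(d, n)) : Prop :=
  forall v : 'rV[F]_n, v != 0 -> (v <= A)%MS -> c (<<v>>%MS) = b.

Definition ramsey_prop (F : finFieldType) (s t n : nat) : Prop :=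
  forall c : 'M[F]_n -> bool,
    (exists A : 'M[F]_(s, n), \rank A = s /\ mono_subspace c true A) \/
    (exists B : 'M[F]_(t, n), \rank B = t /\ mono_subspace c false B).

(* "R_q(s,t) <= x": the minimum n with ramsey_prop exists and is <= x,
   equivalently some n <= x has the property. *)
Definition ramsey_le (F : finFieldType) (s t : nat) {R : realType} (x : R) : Prop :=
  exists n : nat, n%:R <= x /\ ramsey_prop F s t n.

Definition gammaFP (R : realType) : R :=
  inf [set (1 + x + x ^+ 2) / (x `^ (2 / 3)) | x in `]0, 1[%classic].

Definition C0 (R : realType) : R :=
  1 + 1 / (1 - ln (gammaFP R) / ln 3).

(* Main.v *)
Require Import Defs.
From HB Require Import structures.
From mathcomp Require Import all_boot all_order all_algebra all_field.
From mathcomp Require Import all_classical all_reals all_analysis.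
From mathcomp Require Import ring lra zify.
Import Order.TTheory GRing.Theory Num.Theory.
Local Open Scope ring_scope.
Set Implicit Arguments. Unset Strict Implicit. Unset Printing Implicit Defensive.

(** Let [S] be the set of red vectors and suppose no plane is red.  If [S] is
    sparser than [q^-t], a blue [t]-space is built greedily.  Otherwise [S] has
    density at least [q^-t].

    For [q = 3]: if [y + D] is contained in [S] for a subspace [D], then [D] is
    blue, since a red [d] in [D] would span a red plane with [y].  Starting from
    [A = S], replace [A] by [{y | y, y + d, y + 2d in A}] for a popular [d] outside
    the span of the previous ones.  A set of density [a] contains at least
    [(a/6)^C0 9^n] progressions: by the slice rank bound a subset of [F_3^m] has at
    least its size minus [3 gamma^m] nontrivial progressions, and averaging this
    over random affine maps [F_3^m -> F_3^n], with [m] minimal such that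
    [6 gamma^m <= a 3^m], gives the exponent [C0].  So [t] steps cost the exponent
    [C0^t], and [n] of order [t C0^t] is enough.

    For [q = 2]: [D] is blue as soon as every [v] in [D] is a difference of two
    elements of [S].  The six points [0, d1, .., d4, d1+..+d4] have all of
    [<d1, .., d4>] as differences, and a set of density [a] contains a translate of
    such a configuration with frequency at least [a^6], by Cauchy-Schwarz.  So four
    dimensions cost the exponent 6. *)

(** * Slice rank and the cap set bound *)

(** The left kernel of [M] has dimension [r >= a - N]. In a basis of it some [r] columns form an
    invertible block, so a combination of the basis takes the value 1 at all these places. *)
Lemma full_support_in_kernel (F : fieldType) (a N : nat) (M : 'M[F]_(a, N)) :
  exists r (f : 'I_r -> 'I_a) (h : 'rV[F]_a),
    [/\ (a <= N + r)%N, injective f, h *m M = 0 & forall i, h 0 (f i) = 1].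
Proof.
pose B := row_base (kermx M); pose r := \rank (kermx M).
have rfB : row_full B^T by rewrite /row_full mxrank_tr; exact: row_base_free.
pose f := fullrankfun rfB.
have fU : rowsub f B^T \in unitmx by exact: fullrowsub_unit.
pose Q := (invmx (rowsub f B^T))^T.
have HQ : Q *m colsub f B = 1%:M.
  apply: trmx_inj; rewrite trmx_mul trmxK trmx_mxsub mulmxV //.
  by rewrite trmx1.
exists r, f, (const_mx 1 *m Q *m B); split.
- have : (\rank (kermx M) + \rank M)%N = a by rewrite mxrank_ker subnK ?rank_leq_row.
  have := rank_leq_col M; rewrite -/r; lia.
- exact: fullrankfun_inj.
- have /sub_kermxP BM0 : (B <= kermx M)%MS by rewrite eq_row_base.
  by rewrite -(mulmxA _ B) BM0 mulmx0.
- move=> i; transitivity ((const_mx 1 *m (Q *m colsub f B) : 'rV_r) 0 i).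
    by rewrite mulmxA mxE [RHS]mxE; apply: eq_bigr => j _; congr (_ * _); rewrite [RHS]mxE.
  by rewrite HQ mulmx1 mxE.
Qed.

(* Contracting the first slot against a kernel vector of [f1] with large support
   leaves a diagonal matrix of large rank that is a sum of two products. *)
Lemma slice_rank_diagonal (F : fieldType) (a N1 N2 N3 : nat)
    (f1 : 'M[F]_(a, N1)) (g1 : 'I_N1 -> 'I_a -> 'I_a -> F)
    (f2 : 'M[F]_(a, N2)) (g2 : 'I_N2 -> 'I_a -> 'I_a -> F)
    (f3 : 'M[F]_(a, N3)) (g3 : 'I_N3 -> 'I_a -> 'I_a -> F) :
  (forall x y z, ((x == y) && (y == z))%:R =
     \sum_i f1 x i * g1 i y z + \sum_i f2 y i * g2 i x z
     + \sum_i f3 z i * g3 i x y) ->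
  (a <= N1 + (N2 + N3))%N.
Proof.
move=> H; have [r [f [h [le_a injf hf1 hf]]]] := full_support_in_kernel f1.
apply: leq_trans le_a _; rewrite leq_add2l.
pose G2 := \matrix_(j < N2, z < a) \sum_x h 0 x * g2 j x z.
pose G3 := \matrix_(y < a, j < N3) \sum_x h 0 x * g3 j x y.
have E : diag_mx h = f2 *m G2 + G3 *m f3^T.
  apply/matrixP => y z; rewrite !mxE.
  have -> : h 0 y *+ (y == z) = \sum_x h 0 x * ((x == y) && (y == z))%:R.
    rewrite (bigD1 y) //= eqxx big1 ?addr0 ?mulr_natr // => x /negbTE ->.
    by rewrite mulr0.
  under eq_bigr do rewrite H !mulrDr.
  rewrite !big_split /= [X in X + _ + _](_ : _ = 0) ?add0r; last first.
    under eq_bigr do rewrite mulr_sumr.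
    rewrite exchange_big big1 //= => i _.
    transitivity ((h *m f1) 0 i * g1 i y z); last by rewrite hf1 mxE mul0r.
    by rewrite mxE mulr_suml; apply: eq_bigr => x _; rewrite mulrA.
  congr (_ + _).
    under eq_bigr do rewrite mulr_sumr.
    rewrite exchange_big /=; apply: eq_bigr => i _.
    rewrite mxE mulr_sumr.
    by apply: eq_bigr => x _; rewrite mulrCA.
  under eq_bigr do rewrite mulr_sumr.
  rewrite exchange_big /=; apply: eq_bigr => i _; rewrite !mxE mulr_suml.
  by apply: eq_bigr => x _; rewrite mulrCA mulrC.
have E1 : mxsub f f (diag_mx h) = 1%:M.
  apply/matrixP => i j; rewrite !mxE (inj_eq injf).
  by case: eqP => // _; rewrite hf.
have lr : (r <= \rank (diag_mx h))%N.
  rewrite -[X in (X <= _)%N](mxrank1 F r) -E1 mxsubcr -mxrank_tr trmx_mxsub.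
  apply: leq_trans (mxrankS (rowsub_sub _ _)) _.
  by rewrite mxrank_tr; exact: mxrankS (rowsub_sub _ _).
apply: leq_trans lr _; rewrite E; apply: leq_trans (mxrank_add _ _) _.
by apply: leq_add; [apply: leq_trans (mxrankM_maxl _ _) (rank_leq_col _)
                  | apply: leq_trans (mxrankM_maxr _ _) (rank_leq_row _)].
Qed.

(** Exponents of the reduced monomials of degree at most [2n/3]: if three monomials have total
    degree at most [2n], one of them is of this kind. *)
Definition low_degree (n : nat) : {set {ffun 'I_n -> 'I_3}} :=
  [set a : {ffun 'I_n -> 'I_3} | (3 * \sum_i a i <= 2 * n)%N].

Definition monomial (F : comNzRingType) (n : nat) (a : {ffun 'I_n -> 'I_3})
  (x : 'rV[F]_n) : F := \prod_i x 0 i ^+ a i.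

Lemma one_sub_sqr_expansion (F : comNzRingType) :
  exists2 c : 'I_3 * 'I_3 * 'I_3 -> F,
    forall u : 'I_3 * 'I_3 * 'I_3, (2 < u.1.1 + u.1.2 + u.2)%N -> c u = 0
    & forall x y z, 1 - (x + y + z) ^+ 2 =
        \sum_u c u * (x ^+ u.1.1 * y ^+ u.1.2 * z ^+ u.2).
Proof.
pose c (u : 'I_3 * 'I_3 * 'I_3) : F :=
  if (u.1.1 + u.1.2 + u.2 == 0)%N then 1 else
  if (u.1.1 + u.1.2 + u.2 == 2)%N then
    if [|| u.1.1 == 2 :> nat, u.1.2 == 2 :> nat | u.2 == 2 :> nat] then -1 else - 2
  else 0.
exists c => [u|x y z]; first by rewrite /c; case: eqP => [->//|_]; case: eqP => [->|].
rewrite -(pair_bigA _ (fun p k => c (p, k) * (x ^+ p.1 * y ^+ p.2 * z ^+ k))) /=.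
rewrite -(pair_bigA _ (fun i j => \sum_k c (i, j, k) * (x ^+ i * y ^+ j * z ^+ k))) /=.
rewrite !big_ord_recl !big_ord0 /c /=.
ring.
Qed.

Lemma F3_indicator_eq0 (s : 'F_3) : 1 - s ^+ 2 = (s == 0)%:R.
Proof. by apply/eqP; case: s => [[|[|[|s]]] lt_s]. Qed.

(** Grouping by the value of [p] lets one common factor be pulled out of each group; the index type
    ['I_#|L|] is the one that [slice_rank_diagonal] expects. *)
Lemma sum_by_image (V : nmodType) (I J : finType) (P : pred I) (p : I -> J)
    (L : {set J}) (G : I -> V) :
  \sum_(f | P f && (p f \in L)) G f
  = \sum_(j < #|L|) \sum_(f | P f && (p f == enum_val j)) G f.
Proof.
rewrite (partition_big p (mem L)) => [|f /andP[] //].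
rewrite big_enum_val; apply: eq_bigr => j _; apply: eq_bigl => f.
by rewrite -andbA; case: eqP => [->|]; rewrite ?andbF // enum_valP.
Qed.

(** On [A] the diagonal tensor equals the product over [i] of [1 - (x_i + y_i + z_i)^2], of total
    degree at most [2n]. Each of its monomials has degree at most [2n/3] in [x], [y] or [z], and
    grouping by that part gives the slices. *)
Lemma cap_set_bound (n : nat) (A : {set 'rV['F_3]_n}) :
  {in A & &, forall x y z, x + y + z = 0 -> x = y /\ y = z} ->
  (#|A| <= 3 * #|low_degree n|)%N.
Proof.
move=> capA; have [c c0 cE] := one_sub_sqr_expansion 'F_3.
pose J := ('I_3 * 'I_3 * 'I_3)%type.
pose p1 (f : {ffun 'I_n -> J}) := [ffun i => (f i).1.1].
pose p2 (f : {ffun 'I_n -> J}) := [ffun i => (f i).1.2].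
pose p3 (f : {ffun 'I_n -> J}) := [ffun i => (f i).2].
pose C (f : {ffun 'I_n -> J}) := \prod_i c (f i).
pose L := low_degree n; pose e (i : 'I_#|A|) := enum_val i.
pose m (a : {ffun 'I_n -> 'I_3}) i := monomial a (e i).
have -> : (3 * #|L| = #|L| + (#|L| + #|L|))%N by lia.
apply: (@slice_rank_diagonal 'F_3 _ _ _ _
  (\matrix_(x, j) m (enum_val j) x)
  (fun j y z => \sum_(f | true && (p1 f == enum_val j)) C f * m (p2 f) y * m (p3 f) z)
  (\matrix_(y, j) m (enum_val j) y)
  (fun j x z => \sum_(f | (p1 f \notin L) && (p2 f == enum_val j))
     C f * m (p1 f) x * m (p3 f) z)
  (\matrix_(z, j) m (enum_val j) z)
  (fun j x y => \sum_(f | ((p1 f \notin L) && (p2 f \notin L)) && (p3 f == enum_val j))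
     C f * m (p1 f) x * m (p2 f) y)) => x y z.
pose G f := C f * (m (p1 f) x * m (p2 f) y * m (p3 f) z).
transitivity (\sum_f G f).
  transitivity (\prod_i (1 - (e x 0 i + e y 0 i + e z 0 i) ^+ 2)).
    under eq_bigr do rewrite F3_indicator_eq0.
    have [/andP[/eqP-> /eqP->]|ne] := boolP ((x == y) && (y == z)).
      rewrite big1 // => i _; suff -> : e z 0 i + e z 0 i + e z 0 i = 0 by [].
      by apply/eqP; case: (e z 0 i) => [[|[|[|s]]] lt_s].
    have [i nz] : exists i, e x 0 i + e y 0 i + e z 0 i != 0.
      apply/existsP; apply: contraNT ne; rewrite negb_exists => /forallP s0.
      have [] := capA _ _ _ (enum_valP x) (enum_valP y) (enum_valP z).
        by apply/rowP => i; rewrite !mxE; apply/eqP; have := s0 i; rewrite negbK.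
      by move=> /enum_val_inj -> /enum_val_inj ->; rewrite !eqxx.
    by rewrite (bigD1 i) //= (negbTE nz) mul0r.
  under eq_bigr do rewrite cE.
  rewrite bigA_distr_bigA; apply: eq_bigr => f _.
  rewrite !big_split /=; congr (_ * (_ * _ * _));
    by apply: eq_bigr => i _; rewrite ffunE.
(* Each monomial is charged to the first of [x], [y], [z] in which its degree is low. *)
rewrite (bigID (fun f => p1 f \in L)) /= -addrA; congr (_ + _).
  rewrite (sum_by_image xpredT p1); apply: eq_bigr => j _; rewrite mxE mulr_sumr.
  by apply: eq_bigr => f /eqP <-; rewrite /G; ring.
rewrite (bigID (fun f => p2 f \in L)) /=; congr (_ + _).
  rewrite (sum_by_image (fun f => p1 f \notin L) p2); apply: eq_bigr => j _.
  by rewrite mxE mulr_sumr; apply: eq_bigr => f /andP[_ /eqP <-]; rewrite /G; ring.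
rewrite (bigID (fun f => p3 f \in L)) /= [X in _ + X]big1 ?addr0 => [|f /andP[/andP[h1 h2] h3]].
  rewrite (sum_by_image (fun f => (p1 f \notin L) && (p2 f \notin L)) p3).
  apply: eq_bigr => j _.
  by rewrite mxE mulr_sumr; apply: eq_bigr => f /andP[_ /eqP <-]; rewrite /G; ring.
(* All three degrees are high here and sum to more than [2n], so some coordinate has total exponent
   above 2, where [c] vanishes. *)
suff [i lt_i] : exists i, (2 < (f i).1.1 + (f i).1.2 + (f i).2)%N.
  by rewrite /G /C (bigD1 i) //= c0 // !mul0r.
apply/existsP; apply: contraT; rewrite negb_exists => /forallP le2.
have : (\sum_i ((f i).1.1 + (f i).1.2 + (f i).2) <= \sum_(i < n) 2)%N.
  by apply: leq_sum => i _; rewrite leqNgt le2.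
rewrite sum_nat_const card_ord !big_split /=.
have s1 : (\sum_i p1 f i = \sum_i (f i).1.1)%N by apply: eq_bigr => i _; rewrite ffunE.
have s2 : (\sum_i p2 f i = \sum_i (f i).1.2)%N by apply: eq_bigr => i _; rewrite ffunE.
have s3 : (\sum_i p3 f i = \sum_i (f i).2)%N by apply: eq_bigr => i _; rewrite ffunE.
move: h1 h2 h3; rewrite !inE s1 s2 s3.
move: (\sum_i _)%N (\sum_i _)%N (\sum_i _)%N => a1 a2 a3.
rewrite -!ltnNge; lia.
Qed.

(** * Averages over finite types *)

Definition mean (R : numFieldType) (T : finType) (f : T -> R) : R :=
  (\sum_x f x) / #|T|%:R.

Section Mean.
Variables (R : realFieldType) (T : finType).
Implicit Types f g : T -> R.

Lemma eq_mean f g : f =1 g -> mean f = mean g.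
Proof. by move=> fg; rewrite /mean (eq_bigr g). Qed.

Lemma le_mean f g : (forall x, f x <= g x) -> mean f <= mean g.
Proof. by move=> fg; rewrite ler_wpM2r ?invr_ge0 ?ler0n // ler_sum. Qed.

Lemma meanD f g : mean (fun x => f x + g x) = mean f + mean g.
Proof. by rewrite /mean big_split mulrDl. Qed.

Lemma mean_const (t0 : T) (c : R) : mean (fun _ : T => c) = c.
Proof.
rewrite /mean sumr_const -[c *+ _]mulr_natr mulfK // pnatr_eq0 -lt0n.
by apply/card_gt0P; exists t0.
Qed.

Lemma mean_ge0 f : (forall x, 0 <= f x) -> 0 <= mean f.
Proof. by move=> f0; rewrite mulr_ge0 ?invr_ge0 ?ler0n // sumr_ge0. Qed.

Lemma mean_le1 f : (forall x, f x <= 1) -> mean f <= 1.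
Proof.
move=> f1; case: (pickP (predT : pred T)) => [t _|T0].
  by apply: le_trans (le_mean f1) _; rewrite (mean_const t).
by rewrite /mean big_pred0 ?mul0r // => x; have := T0 x.
Qed.

Lemma mean_sum (I : finType) (P : pred I) (F : I -> T -> R) :
  mean (fun x => \sum_(i | P i) F i x) = \sum_(i | P i) mean (F i).
Proof. by rewrite /mean exchange_big mulr_suml. Qed.

Lemma exchange_mean (U : finType) (F : T -> U -> R) :
  mean (fun x => mean (F x)) = mean (fun y => mean (F^~ y)).
Proof.
by rewrite /mean -!mulr_suml exchange_big mulrAC.
Qed.

(** Otherwise [f] is at most 1 on [D] and below [x - delta] elsewhere, which makes its mean smaller
    than [x]. Avoiding [D] thus costs [delta]. *)
Lemma mean_avoid (t0 : T) (D : {set T}) f (x delta : R) :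
  (forall t, 0 <= f t <= 1) -> x <= mean f -> #|D|%:R <= delta * #|T|%:R ->
  delta < x -> exists2 d, d \notin D & x - delta <= f d.
Proof.
move=> f01 xf Dd lt_x; apply/exists_inP; apply: contraT.
rewrite negb_exists_in => /forall_inP h.
have T0 : 0 < #|T|%:R :> R by rewrite ltr0n; apply/card_gt0P; exists t0.
move: xf; rewrite ler_pdivlMr // leNgt => /negP[].
apply: (@lt_le_trans _ _ (\sum_t ((t \in D)%:R + (x - delta)))).
  apply: ltr_sum => [|t _]; first by apply/hasP; exists t0; rewrite ?mem_index_enum.
  have /andP[_ ft1] := f01 t; have := h t; case: (t \in D) => /=; first by move=> _; lra.
  move=> /(_ isT); rewrite -ltNge add0r. by [].
rewrite big_split /= sumr_const -natr_sum -big_mkcond sum1_card -(mulr_natr (x - delta)) mulrBl; lra.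
Qed.

End Mean.

Lemma mean_translate (R : realFieldType) (V : finZmodType) (f : V -> R) (a : V) :
  mean (fun x => f (x + a)) = mean f.
Proof. by rewrite /mean [in RHS](reindex_inj (addIr a)). Qed.

(** With [e *m g = 1], translating [M] by [g *m d] shifts [e *m M] by [d]; averaging over [d] shows
    that [e *m M] is uniform. *)
Lemma mean_mulmx (R : realFieldType) (F : finFieldType) (m n : nat)
    (e : 'rV[F]_m) (f : 'rV[F]_n -> R) :
  e != 0 -> mean (fun M : 'M[F]_(m, n) => f (e *m M)) = mean f.
Proof.
move=> e0; have [g eg] : exists g : 'cV_m, e *m g = 1%:M.
  by exists (pinvmx e); rewrite mulmxVp // /row_free rank_rV e0.
rewrite -[LHS](mean_const (0 : 'rV[F]_n)).
transitivity (mean (fun d : 'rV[F]_n => mean (fun M : 'M[F]_(m, n) => f (e *m M + d)))).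
  apply: eq_mean => d; rewrite -[LHS](mean_translate _ (g *m d)).
  by apply: eq_mean => M; rewrite mulmxDr mulmxA eg mul1mx.
rewrite exchange_mean -[RHS](mean_const (0 : 'M[F]_(m, n))).
by apply: eq_mean => M; rewrite -[RHS](mean_translate _ (e *m M)); apply: eq_mean => d; rewrite addrC.
Qed.

(** * Three-term progressions in sets over the field with three elements *)

Definition ap3_set (n : nat) (A : {set 'rV['F_3]_n}) : {set 'rV['F_3]_n * 'rV['F_3]_n} :=
  [set p | [&& p.2 != 0, p.1 \in A, p.1 + p.2 \in A & p.1 + p.2 + p.2 \in A]].

(** Removing the first point of a nontrivial progression lowers both sides, the right one by at
    least 1; when none is left, the set is a cap set. *)
Lemma card_le_ap3_set (n : nat) (A : {set 'rV['F_3]_n}) :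
  (#|A| <= 3 * #|low_degree n| + #|ap3_set A|)%N.
Proof.
have [k] := ubnP #|A|; elim: k A => // k IH A leA.
have [H|[[x d]]] := set_0Vmem (ap3_set A).
  rewrite H cards0 addn0; apply: cap_set_bound => x y z xA yA zA s0.
  (* In characteristic 3, [x + y + z = 0] says that [x, y, z] is a progression. *)
  have zE : z = x + (y - x) + (y - x).
    apply/rowP => i; have := congr1 (fun u : 'rV_n => u 0 i) s0; rewrite !mxE.
    move: (x 0 i) (y 0 i) (z 0 i) => a b c abc.
    have b3 : b + b + b = 0 by apply/eqP; case: b {abc} => [[|[|[|?]]] ?].
    apply/eqP; rewrite -subr_eq0.
    by rewrite [X in X == _](_ : _ = a + b + c - (b + b + b)); [rewrite abc b3 subrr | ring].
  have [d0|d0] := eqVneq (y - x) 0.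
    by rewrite zE d0 !addr0; move/eqP: d0; rewrite subr_eq0 => /eqP ->.
  have : (x, y - x) \in ap3_set A by rewrite inE /= d0 xA -zE zA [x + _]addrC subrK yA.
  by rewrite H inE.
rewrite inE /= => /and4P[d0 xA x1A x2A].
have /IH : (#|A :\ x| < k)%N by rewrite (cardsD1 x) xA in leA.
rewrite [in X in _ -> X](cardsD1 x) xA add1n => /leq_ltn_trans; apply.
rewrite ltn_add2l; apply: proper_card; apply/properP; split.
  by apply/fintype.subsetP => p; rewrite !inE => /and4P[-> /andP[_ ->] /andP[_ ->] /andP[_ ->]].
by exists (x, d); rewrite !inE ?eqxx ?andbF //= d0 xA x1A x2A.
Qed.

Definition density (R : numFieldType) (T : finType) (A : {set T}) : R :=
  mean (fun x => (x \in A)%:R).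

(** Unlike [ap3_set], this also counts the trivial progressions, with [d = 0]. *)
Definition ap3_density (R : numFieldType) (n : nat) (A : {set 'rV['F_3]_n}) : R :=
  mean (fun d => density R [set x | [&& x \in A, x + d \in A & x + d + d \in A]]).

Lemma densityE (R : numFieldType) (T : finType) (A : {set T}) :
  density R A = #|A|%:R / #|T|%:R.
Proof. by rewrite /density /mean -natr_sum -big_mkcond sum1_card. Qed.

Lemma natr_card (R : numFieldType) (T : finType) (A : {set T}) :
  #|A|%:R = \sum_x (x \in A)%:R :> R.
Proof. by rewrite -natr_sum -big_mkcond sum1_card. Qed.

Lemma density_01 (R : realFieldType) (T : finType) (A : {set T}) :
  0 <= density R A <= 1.
Proof. by rewrite mean_ge0 ?mean_le1 // => x; rewrite ?ler0n ?lern1 ?leq_b1. Qed.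

Lemma ap3_density_ge0 (R : realFieldType) (n : nat) (A : {set 'rV['F_3]_n}) :
  0 <= ap3_density R A.
Proof. by apply: mean_ge0 => d; set E := finset _; have /andP[] := density_01 R E. Qed.

Lemma card_rowF3 n : #|{: 'rV['F_3]_n}| = (3 ^ n)%N.
Proof. by rewrite card_mx card_Fp // mul1n. Qed.

(* Pull [A] back along a uniformly random affine map [u |-> u *m M + b] from
   [F_3^m]: distinct points become uniform and independent, so the expected number of
   progressions is governed by [ap3_density], while the cap set bound gives many
   progressions in every pullback. *)
Lemma ap3_density_ge (R : realFieldType) (m n : nat) (A : {set 'rV['F_3]_n}) :
  density R A * 3 ^+ m - (3 * #|low_degree m|)%:R <= ap3_density R A * 3 ^+ m * 3 ^+ m.
Proof.
pose phi (M : 'M['F_3]_(m, n)) b := [set u | u *m M + b \in A].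
have cM : mean (fun M => mean (fun b => #|phi M b|%:R)) = density R A * 3 ^+ m.
  rewrite -[RHS](mean_const (0 : 'M['F_3]_(m, n))); apply: eq_mean => M.
  under eq_mean do rewrite natr_card.
  rewrite mean_sum (eq_bigr (fun _ => density R A)) => [|u _].
    by rewrite sumr_const card_rowF3 -natrX mulr_natr.
  rewrite -[RHS](mean_translate _ (u *m M)); apply: eq_mean => b.
  by rewrite inE addrC.
have cP : mean (fun M => mean (fun b => #|ap3_set (phi M b)|%:R))
    <= ap3_density R A * 3 ^+ m * 3 ^+ m.
  under eq_mean do under eq_mean do rewrite natr_card.
  under eq_mean do rewrite mean_sum.
  rewrite mean_sum -mulrA -exprD -natrX mulr_natr expnD -card_rowF3 -card_prod -sumr_const.
  apply: ler_sum => -[u e] _; have [->|e0] := eqVneq e 0.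
    rewrite (eq_mean (g := fun=> 0)) ?(mean_const (0 : 'M['F_3]_(m, n))).
      exact: ap3_density_ge0.
    move=> M; rewrite -[RHS](mean_const (0 : 'rV['F_3]_n)); apply: eq_mean => b.
    by rewrite inE eqxx.
  rewrite /ap3_density -(mean_mulmx _ e0); apply: le_mean => M.
  rewrite /density -[X in _ <= X](mean_translate _ (u *m M)); apply: le_mean => b.
  rewrite !inE e0 /= !mulmxDl; set p := u *m M; set q := e *m M.
  by rewrite [p + b]addrC [p + q + b]addrC [p + q + q + b]addrC !addrA.
rewrite lerBlDr -cM; apply: le_trans (lerD cP (lexx _)).
rewrite -[X in _ <= _ + X](mean_const (0 : 'M['F_3]_(m, n))) -meanD.
apply: le_mean => M.
rewrite -[X in _ <= _ + X](mean_const (0 : 'rV['F_3]_n)) -meanD.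
by apply: le_mean => b; rewrite -natrD ler_nat addnC card_le_ap3_set.
Qed.

(** * The constants [gammaFP] and [C0] *)

(** Give the exponent vector [a] the weight [x] to its degree. All weights sum to [(1 + x + x^2)^m],
    and those of low degree weigh at least [x^(2m/3)] since [x < 1]. *)
Lemma low_degree_le_weight (R : realType) (m : nat) (x : R) : 0 < x < 1 ->
  #|low_degree m|%:R <= ((1 + x + x ^+ 2) / x `^ (2 / 3)) ^+ m.
Proof.
move=> /andP[x0 x1]; set w := x `^ (2 / 3).
have w0 : 0 < w by rewrite powR_gt0.
have w3 : w ^+ 3 = x ^+ 2.
  rewrite -powR_mulrn ?(ltW w0) // /w -powRrM -powR_mulrn ?(ltW x0) //.
  by congr (_ `^ _); field.
rewrite expr_div_n ler_pdivlMr ?exprn_gt0 //.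
have -> : (1 + x + x ^+ 2) ^+ m = \sum_(a : {ffun 'I_m -> 'I_3}) x ^+ (\sum_i a i).
  transitivity (\prod_(i < m) \sum_(j < 3) x ^+ j).
    by rewrite prodr_const card_ord !big_ord_recl big_ord0 /= expr0 addr0 addrA.
  by rewrite bigA_distr_bigA; apply: eq_bigr => a _; rewrite prodrXr.
rewrite mulr_natl -sumr_const.
rewrite [X in _ <= X](bigID (mem (low_degree m))) /= -[X in X <= _]addr0 lerD //; last first.
  by apply: sumr_ge0 => a _; rewrite exprn_ge0 // ltW.
apply: ler_sum => a; rewrite inE => le_a.
rewrite -(@ler_pXn2r _ 3) ?nnegrE ?exprn_ge0 ?(ltW x0) ?(ltW w0) //.
rewrite -!exprM mulnC exprM w3 -exprM.
by rewrite ler_wiXn2l ?(ltW x0) ?(ltW x1) // mulnC.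
Qed.

Section GammaFP.
Variable R : realType.
Implicit Types x : R.

Let ratio x : R := (1 + x + x ^+ 2) / x `^ (2 / 3).
Local Notation gamma := (gammaFP R).

Lemma gammaFP_le x : 0 < x < 1 -> gamma <= ratio x.
Proof.
move=> x01; apply: ge_inf; last by exists x => //=; rewrite in_itv.
exists 0 => z [y /=]; rewrite in_itv /= => /andP[y0 _] <-.
by rewrite divr_ge0 ?powR_ge0 // !addr_ge0 ?sqr_ge0 ?(ltW y0).
Qed.

Lemma le_gammaFP (c : R) : (forall x, 0 < x < 1 -> c <= ratio x) -> c <= gamma.
Proof.
move=> le_c; apply: lb_le_inf; first by exists (ratio 2^-1), 2^-1 => //=; rewrite in_itv /=; lra.
by move=> z [y /=]; rewrite in_itv /= => /le_c ? <-.
Qed.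

Lemma gammaFP_ge1 : 1 <= gamma.
Proof.
apply: le_gammaFP => x /andP[x0 x1]; rewrite ler_pdivlMr ?powR_gt0 // mul1r.
apply: (@le_trans _ _ 1); last by rewrite -addrA lerDl addr_ge0 ?sqr_ge0 ?(ltW x0).
apply: (@le_trans _ _ (1 `^ (2 / 3))); last by rewrite powR1.
by rewrite ge0_ler_powR ?nnegrE ?(ltW x0) ?(ltW x1) //; lra.
Qed.

Lemma gammaFP_lt3 : gamma < 3.
Proof.
(* At 1/2 the claim is [7/4 < 3w] with [w^3 = 1/4]; on cubing, [343/64 < 27/4]. *)
apply: le_lt_trans (gammaFP_le (x := 2^-1) _) _; first lra.
rewrite /ratio ltr_pdivrMr ?powR_gt0 ?invr_gt0 //.
set w := _ `^ _; have w0 : 0 < w by rewrite powR_gt0 ?invr_gt0.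
have w3 : w ^+ 3 = 2^-1 ^+ 2.
  rewrite -powR_mulrn ?(ltW w0) // /w -powRrM -powR_mulrn ?invr_ge0 //.
  by congr (_ `^ _); field.
rewrite -(@ltr_pXn2r _ 3) ?nnegrE ?mulr_ge0 ?(ltW w0) //; lra.
Qed.

(** As [gammaFP] is an infimum, the bound for each [x] is passed to it through [m]-th roots, which
    leaves [m = 0] to be treated apart. *)
Lemma low_degree_le_gammaFP m : #|low_degree m|%:R <= gamma ^+ m.
Proof.
case: m => [|m]; first by have := @low_degree_le_weight R 0 2^-1; rewrite !expr0; apply; lra.
set N : R := _%:R; have N0 : 0 <= N by rewrite ler0n.
have rootK (y : R) : 0 <= y -> (y `^ (m.+1%:R)^-1) ^+ m.+1 = y.
  by move=> y0; rewrite -powR_mulrn ?powR_ge0 // -powRrM mulVf ?pnatr_eq0 // powRr1.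
rewrite -[X in X <= _]rootK // ler_pXn2r ?nnegrE ?powR_ge0 ?(le_trans ler01 gammaFP_ge1) //.
apply: le_gammaFP => x x01; have /andP[x0 x1] := x01.
have r0 : 0 <= ratio x by rewrite (le_trans _ (gammaFP_le x01)) ?(le_trans ler01 gammaFP_ge1).
rewrite -(@ler_pXn2r _ m.+1) ?nnegrE ?powR_ge0 // rootK //.
exact: low_degree_le_weight.
Qed.

Let l : R := ln gamma / ln 3.

Let ln3_gt0 : 0 < ln 3 :> R. Proof. by rewrite ln_gt0 // ltr1n. Qed.

Let ln_gamma_lt : ln gamma < ln 3 :> R.
Proof. by rewrite ltr_ln ?posrE ?gammaFP_lt3 // (lt_le_trans ltr01 gammaFP_ge1). Qed.

Lemma C0_ge2 : 2 <= C0 R.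
Proof.
rewrite /C0 -/l (_ : 2 = 1 + 1) // lerD2l div1r invf_ge1.
  by rewrite gerBl; apply: divr_ge0; [rewrite ln_ge0 ?gammaFP_ge1 | apply: ltW].
by rewrite subr_gt0 ltr_pdivrMr // mul1r.
Qed.

Lemma C0E : C0 R = 1 + ln 3 / (ln 3 - ln gamma).
Proof.
rewrite /C0; congr (_ + _); field.
by rewrite gt_eqF ?subr_gt0 // gt_eqF.
Qed.

(** The cap set term is at most half of [a * 3^m] once [6 gamma^m <= a * 3^m], so [a/2 <= T * 3^m].
    With [3^m <= 3 (6/a)^(C0 - 1)] this is the claim. *)
Lemma ap3_density_ge_powR n (A : {set 'rV['F_3]_n}) :
  (density R A / 6) `^ C0 R <= ap3_density R A.
Proof.
move: (density_01 R A) (fun m => ap3_density_ge R m A) (ap3_density_ge0 R A).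
move: (density R A) (ap3_density R A) => a T /andP[a0 a1] geT T0.
have [->|a_neq0] := eqVneq a 0.
  by rewrite mul0r powR0 // gt_eqF // (lt_le_trans _ C0_ge2).
have {a0 a_neq0} a0 : 0 < a by rewrite lt_def a_neq0.
set D := ln 3 - ln gamma; have D0 : 0 < D by rewrite subr_gt0.
(* [y] solves [6 gamma^y = a * 3^y], and [3^y = (6/a)^(C0 - 1)]; rounding up to [m] costs at most
   the factor 3. *)
pose y := ln (6 / a) / D; pose m := (Num.truncn y).+1.
have y0 : 0 <= y by rewrite divr_ge0 ?(ltW D0) // ln_ge0 // ler_pdivlMr //; lra.
have /andP[ym my] : y <= m%:R <= y + 1.
  by have /andP[h1 h2] := Num.Theory.truncn_itv y0; rewrite /m (ltW h2) -natr1 lerD2r.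
clearbody m.
have g0 : 0 < gamma by rewrite (lt_le_trans ltr01 gammaFP_ge1).
have le1 : 6 * gamma ^+ m <= a * 3 ^+ m.
  rewrite -[leLHS]lnK ?posrE ?mulr_gt0 ?exprn_gt0 // -[leRHS]lnK ?posrE ?mulr_gt0 ?exprn_gt0 //.
  rewrite ler_expR !lnM ?posrE ?exprn_gt0 // !lnXn //.
  move: ym; rewrite /y ler_pdivrMr // ln_div ?posrE // /D -(mulr_natl (ln gamma)) -(mulr_natl (ln 3)); lra.
have le2 : 3 ^+ m <= 3 * (6 / a) `^ (C0 R - 1).
  rewrite -powR_mulrn //; apply: le_trans (ler_powR _ my) _; first lra.
  rewrite (@powRD _ 3) ?pnatr_eq0 ?implybT // powRr1 // mulrC ler_pM2l // C0E addrC addKr -/D.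
  rewrite /powR gt_eqF // gt_eqF ?divr_gt0 // ler_expR /y le_eqVlt; apply/orP; left.
  by apply/eqP; field; rewrite gt_eqF.
have {}le1 : a * 3 ^+ m / 2 <= T * 3 ^+ m * 3 ^+ m.
  apply: le_trans (geT m).
  have := low_degree_le_gammaFP m; rewrite natrM; lra.
have m0 : 0 < 3 ^+ m :> R by rewrite exprn_gt0.
have le3 : a / 2 <= T * 3 ^+ m.
  by rewrite -(ler_pM2r m0); apply: le_trans le1; rewrite mulrAC.
have inv : (a / 6) `^ (C0 R - 1) * (6 / a) `^ (C0 R - 1) = 1.
  rewrite -powRM ?divr_ge0 ?(ltW a0) // mulrA divfK // mulfV ?gt_eqF //.
  by rewrite powR1.
have w0 : 0 < (6 / a) `^ (C0 R - 1) by rewrite powR_gt0 // divr_gt0.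
rewrite -[C0 R](subrK 1) powRD ?powRr1 ?divr_ge0 ?(ltW a0) //; last first.
  by apply/implyP => _; rewrite gt_eqF // divr_gt0.
rewrite -(ler_pM2r w0) mulrAC inv mul1r.
have := ler_wpM2l T0 le2; lra.
Qed.

End GammaFP.

(** * Row spaces and greedy avoidance *)

Section RowSpaces.
Variables (F : finFieldType) (n : nat).
Implicit Types (S : {set 'rV[F]_n}) (v d : 'rV[F]_n).

Definition row_space (k : nat) (B : 'M[F]_(k, n)) : {set 'rV[F]_n} :=
  [set v | (v <= B)%MS].

Lemma card_row_space (k : nat) (B : 'M[F]_(k, n)) : (#|row_space B| <= #|F| ^ k)%N.
Proof.
apply: (@leq_trans #|[set u *m B | u : 'rV[F]_k]|).
  by apply/subset_leq_card/fintype.subsetP => v; rewrite inE => /submxP[u ->]; apply/imsetP; exists u.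
by apply: leq_trans (leq_imset_card _ _) _; rewrite card_mx mul1n.
Qed.

Lemma row_free_col_mx (k : nat) d (B : 'M[F]_(k, n)) :
  row_free B -> d \notin row_space B -> row_free (col_mx d B).
Proof.
rewrite inE => /eqP rB dB; rewrite /row_free eqn_leq rank_leq_row /= -[X in (X <= _)%N]/(k.+1) -{1}rB.
apply: rank_ltmx; rewrite ltmxE -!addsmxE addsmxSr /= addsmx_sub negb_and dB //.
Qed.

Lemma row_space_col_mxP (k : nat) d (B : 'M[F]_(k, n)) v :
  v \in row_space (col_mx d B) -> exists a w, w \in row_space B /\ v = a *: d + w.
Proof.
rewrite inE => /submxP[u ->]; exists (lsubmx u 0 0), (rsubmx u *m B).
by rewrite inE submxMl -{1}[u]hsubmxK mul_row_col {1}[lsubmx u]mx11_scalar mul_scalar_mx.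
Qed.

Definition scale_closed S := forall (a : F) v, a != 0 -> v \in S -> a *: v \in S.

(** Greedy extension: if [a *: d + w] lies in [S] with [a != 0], scaling puts [d] in [S] minus the
    row space. So a new [d] has at most [(#|S| + 1) q^k] forbidden values, with [k <= t - 1]. *)
Lemma avoiding_row_space (t : nat) S : 0 \notin S -> scale_closed S ->
  (#|F| ^ t.-1 * #|S|.+1 < #|F| ^ n)%N ->
  exists2 B : 'M[F]_(t, n), row_free B & {in row_space B, forall v, v \notin S}.
Proof.
move=> S0 Ssc small; have F1 : (0 < #|F|)%N by apply/card_gt0P; exists 0.
suff H k : (k <= t)%N ->
    exists2 B : 'M[F]_(k, n), row_free B & {in row_space B, forall v, v \notin S}.
  exact: H.
elim: k => [_|k IH lt_kt].
  exists 0 => [|v]; first by rewrite /row_free mxrank0.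
  by rewrite inE => /submxP[u ->]; rewrite [u]thinmx0 mul0mx.
have [B fB avB] := IH (ltnW lt_kt).
pose bad := row_space B :|: [set p.1 - p.2 | p in finset.setX S (row_space B)].
have [d dbad] : exists d, d \notin bad.
  apply/existsP; apply: contraLR small; rewrite negb_exists => /forallP allbad.
  rewrite -leqNgt (_ : #|F| ^ n = #|{: 'rV[F]_n}|)%N; last by rewrite card_mx mul1n.
  apply: (@leq_trans #|bad|).
    by apply/subset_leq_card/fintype.subsetP => d _; have := allbad d; rewrite negbK.
  apply: leq_trans (leq_card_setU _ _) _.
  apply: (@leq_trans (#|row_space B| + #|S| * #|row_space B|)).
    by rewrite leq_add2l; apply: leq_trans (leq_imset_card _ _) _; rewrite cardsX.
  rewrite -mulSn mulnC leq_mul2r; apply/orP; right.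
  apply: leq_trans (card_row_space B) _.
  by rewrite leq_pexp2l // -ltnS prednK // (leq_ltn_trans _ lt_kt).
move: dbad; rewrite finset.in_setU negb_or => /andP[dB dS].
exists (col_mx d B); first exact: row_free_col_mx.
move=> v /row_space_col_mxP[a [w [wB ->]]].
have [->|a0] := eqVneq a 0; first by rewrite scale0r add0r avB.
apply: contra dS => vS; apply/imsetP; exists (a^-1 *: (a *: d + w), a^-1 *: w).
  rewrite inE /= Ssc ?invr_eq0 //= inE scalemx_sub //.
  by rewrite inE in wB.
by rewrite /= scalerDr scalerA mulVf // scale1r addrK.
Qed.

End RowSpaces.

(** * Colourings and their red vectors *)

Section Colouring.
Variables (F : finFieldType) (n : nat) (c : 'M[F]_n -> bool).

Definition red_set : {set 'rV[F]_n} := [set v | (v != 0) && c <<v>>%MS].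

Lemma zero_notin_red_set : 0 \notin red_set.
Proof. by rewrite inE eqxx. Qed.

Lemma red_set_scale_closed : scale_closed red_set.
Proof.
move=> a v a0; rewrite !inE => /andP[v0 cv]; rewrite scaler_eq0 negb_or a0 v0 /=.
by rewrite (eq_genmx (eqmx_scale v a0)).
Qed.

Lemma mono_blue (t : nat) (B : 'M[F]_(t, n)) :
  {in row_space B, forall v, v \notin red_set} -> mono_subspace c false B.
Proof. by move=> avB v v0 vB; have := avB v; rewrite !inE v0 => /(_ vB) /negbTE. Qed.

(** If [v] were red too, [y] and [v] would span a red plane: [a y + b v] is a multiple of
    [y + (b/a) v], or of [v] when [a = 0]. They are independent because the affine line misses 0. *)
Lemma red_affine_line v :
  ~ (exists A : 'M[F]_(2, n), \rank A = 2 /\ mono_subspace c true A) ->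
  (exists y, forall a, y + a *: v \in red_set) -> v \notin red_set.
Proof.
move=> no_red [y yv]; apply/negP => vS; apply: no_red; exists (col_mx y v).
have yB : y \notin row_space v.
  rewrite inE; apply/negP => /sub_rVP[a ya]; have := yv (- a).
  by rewrite ya scaleNr subrr (negbTE zero_notin_red_set).
have fv : row_free v.
  by rewrite /row_free rank_rV; move: vS; rewrite inE => /andP[->].
split; first by apply/eqP; exact: row_free_col_mx.
move=> u u0 uA; have : u \in row_space (col_mx y v) by rewrite inE.
case/row_space_col_mxP => a [w [+ uE]]; rewrite inE => /sub_rVP[b wE].
suff : u \in red_set by rewrite inE => /andP[].
have [a0|a0] := eqVneq a 0.
  move: u0; rewrite uE wE a0 scale0r add0r scaler_eq0 negb_or => /andP[b0 _].
  exact: red_set_scale_closed.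
rewrite uE wE -[b]mul1r -(divff a0) -mulrA -scalerA -scalerDr.
exact: red_set_scale_closed.
Qed.

Lemma blue_or_dense (R : realFieldType) (t : nat) : (0 < t)%N -> (t <= n)%N ->
  (exists B : 'M[F]_(t, n), \rank B = t /\ mono_subspace c false B) \/
  #|F|%:R ^- t <= density R red_set.
Proof.
move=> t0 tn; have F1 : (1 < #|F|)%N by rewrite card_finNzRing_gt1.
have [small|] := ltnP (#|F| ^ t.-1 * #|red_set|.+1) (#|F| ^ n).
  left; have [B fB avB] := avoiding_row_space zero_notin_red_set red_set_scale_closed small.
  by exists B; split; [apply/eqP | apply: mono_blue].
move=> large; right; rewrite densityE card_mx mul1n.
rewrite ler_pdivlMr ?ltr0n ?expn_gt0 ?(ltnW F1) // mulrC ler_pdivrMr ?exprn_gt0 ?ltr0n ?(ltnW F1) //.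
rewrite -natrX -natrM ler_nat; apply: (leq_trans large).
rewrite -{2}(prednK t0) expnS [leqRHS]mulnA [leqRHS]mulnC leq_mul2l; apply/orP; right.
(* For nonempty [red_set], [#|red_set| + 1 <= q #|red_set|]; an empty one would give
   [q^n <= q^(t-1)], against [t <= n]. *)
have [red0|] := posnP #|red_set|; last by nia.
by move: large; rewrite red0 muln1 leq_exp2l // leqNgt prednK // tn.
Qed.

End Colouring.

(** * The iteration for q = 3 *)

Lemma ap3_step (R : realType) (n k : nat) (B : 'M['F_3]_(k, n)) (A : {set 'rV['F_3]_n})
    (delta : R) :
  3 ^+ k <= delta * 3 ^+ n -> delta < (density R A / 6) `^ C0 R ->
  exists2 d, d \notin row_space B & (density R A / 6) `^ C0 R - delta <=
    density R [set y | [&& y \in A, y + d \in A & y + d + d \in A]].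
Proof.
move=> kn lt_delta; apply: (mean_avoid (0 : 'rV_n)) => //.
- by move=> d; exact: density_01.
- exact: ap3_density_ge_powR.
- rewrite card_rowF3 natrX; apply: le_trans kn; rewrite -natrX ler_nat.
  by have := card_row_space B; rewrite card_Fp.
Qed.

Lemma F3_cases (a : 'F_3) : [\/ a = 0, a = 1 | a = 1 + 1].
Proof.
case: a => [[|[|[|a]]] lt_a] //; [constructor 1|constructor 2|constructor 3];
  by apply/eqP.
Qed.

(* The factor 81 absorbs the losses: [(81/6)^C0 - 1 >= (81/6)^2 - 1 >= 81]. *)
Lemma F3_translate_chain (R : realType) (n t : nat) (S : {set 'rV['F_3]_n}) (x : R) :
  0 < x <= 1 -> 81 * x <= density R S -> 3 ^+ t <= x `^ (C0 R ^+ t) * 3 ^+ n ->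
  forall k, (k <= t)%N -> exists (B : 'M['F_3]_(k, n)) (A : {set 'rV['F_3]_n}),
    [/\ row_free B, {in A & row_space B, forall y v, y + v \in S}
      & 81 * x `^ (C0 R ^+ k) <= density R A].
Proof.
move=> /andP[x0 x1] xS tn; have C2 := C0_ge2 R.
have C0_gt0 : 0 < C0 R by lra.
elim=> [_|k IH lt_kt].
  exists 0, S; split; first by rewrite /row_free mxrank0.
    by move=> y v yS; rewrite inE => /submxP[u ->]; rewrite [u]thinmx0 mul0mx addr0.
  by rewrite expr0 powRr1 // ltW.
have [B [A [fB BA dA]]] := IH (ltnW lt_kt).
(* [z] is both the scale of the next density and the allowance [delta] for excluded directions. *)
set z := x `^ (C0 R ^+ k.+1); have z0 : 0 < z by rewrite powR_gt0.
have zt : x `^ (C0 R ^+ t) <= z.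
  by apply: ger_powR; rewrite ?x0 //; apply: ler_weXn2l; rewrite //; lra.
have big : 182 * z <= (density R A / 6) `^ C0 R.
  apply: (@le_trans _ _ ((27 / 2 * x `^ (C0 R ^+ k)) `^ C0 R)); last first.
    have /andP[dA0 _] := density_01 R A.
    apply: ge0_ler_powR; first exact: ltW; last lra.
      by rewrite nnegrE mulr_ge0 ?powR_ge0.
    by rewrite nnegrE divr_ge0.
  rewrite powRM ?powR_ge0 // -powRrM -exprSr ler_pM2r //.
  apply: (@le_trans _ _ ((27 / 2) `^ 2)); last by apply: ler_powR; lra.
  rewrite powR_mulrn //; lra.
have [||d dB dA'] := @ap3_step R n k B A z.
- apply: (@le_trans _ _ (3 ^+ t)); first by rewrite ler_weXn2l ?ler1n // ltnW.
  by apply: le_trans tn _; rewrite ler_pM2r ?exprn_gt0.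
- lra.
exists (col_mx d B), [set y | [&& y \in A, y + d \in A & y + d + d \in A]].
split; [exact: row_free_col_mx| |lra].
move=> y v; rewrite inE => /and3P[y1 y2 y3] /row_space_col_mxP[a [w [wB ->]]].
rewrite addrA; have [->|->|->] := F3_cases a.
- by rewrite scale0r addr0 BA.
- by rewrite scale1r BA.
- by rewrite scalerDl scale1r addrA BA.
Qed.

(** * The iteration for q = 2 *)

Section MeanAlgebra.
Variables (R : realFieldType) (T : finType).

Lemma mean_mull (c : R) (f : T -> R) : mean (fun x => c * f x) = c * mean f.
Proof. by rewrite /mean -mulr_sumr mulrA. Qed.

Lemma mean_mulr (c : R) (f : T -> R) : mean (fun x => f x * c) = mean f * c.
Proof. by rewrite /mean -mulr_suml mulrAC. Qed.

Lemma sqr_mean_le (t0 : T) (f : T -> R) : mean f ^+ 2 <= mean (fun x => f x ^+ 2).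
Proof.
have : 0 <= mean (fun x => (f x - mean f) ^+ 2) by apply: mean_ge0 => x; exact: sqr_ge0.
rewrite (eq_mean (g := fun x => f x ^+ 2 + (f x * (- 2 * mean f) + mean f ^+ 2))).
  by rewrite !meanD mean_mulr (mean_const t0); nra.
by move=> x; ring.
Qed.

End MeanAlgebra.

Lemma card_rowF2 n : #|{: 'rV['F_2]_n}| = (2 ^ n)%N.
Proof. by rewrite card_mx card_Fp // mul1n. Qed.

(* All 15 nonzero vectors of the span of four independent [d_i] are
   differences of two of the six points of this configuration. *)
Definition sidon_translates (n : nat) (d1 d2 d3 d4 : 'rV['F_2]_n) : seq 'rV['F_2]_n :=
  [:: 0; d1; d2; d3; d4; d1 + d2 + d3 + d4].

Definition sidon_inter (n : nat) (A : {set 'rV['F_2]_n}) (d1 d2 d3 d4 : 'rV['F_2]_n) :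
    {set 'rV['F_2]_n} :=
  [set y | all (fun p => y + p \in A) (sidon_translates d1 d2 d3 d4)].

Lemma F2_cases (a : 'F_2) : a = 0 \/ a = 1.
Proof. by case: a => [[|[|a]] lt_a] //; [left|right]; apply/eqP. Qed.

(** By the number of nonzero coefficients: up to one, use 0 and a [d_i]; two, the two [d_i]; three,
    the full sum and the missing [d_i]; four, the full sum and 0. *)
Lemma mem_sidon_translates (n : nat) (d1 d2 d3 d4 : 'rV['F_2]_n) (a1 a2 a3 a4 : 'F_2) :
  exists p q, [/\ p \in sidon_translates d1 d2 d3 d4, q \in sidon_translates d1 d2 d3 d4
    & p = q + (a1 *: d1 + (a2 *: d2 + (a3 *: d3 + a4 *: d4)))].
Proof.
set s := d1 + d2 + d3 + d4; set o : 'rV['F_2]_n := 0.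
Local Ltac solve_with p q :=
  exists p, q; split; rewrite ?inE ?eqxx ?orbT //; apply/rowP => ?; rewrite !mxE;
  repeat match goal with |- context [fun_of_matrix ?d ?k ?j] =>
    case: (F2_cases (d k j)) => -> end; apply/eqP.
case: (F2_cases a1) => ->; case: (F2_cases a2) => ->;
case: (F2_cases a3) => ->; case: (F2_cases a4) => ->.
- by solve_with o o.
- by solve_with d4 o.
- by solve_with d3 o.
- by solve_with d3 d4.
- by solve_with d2 o.
- by solve_with d2 d4.
- by solve_with d2 d3.
- by solve_with s d1.
- by solve_with d1 o.
- by solve_with d1 d4.
- by solve_with d1 d3.
- by solve_with s d2.
- by solve_with d1 d2.
- by solve_with s d3.
- by solve_with s d4.
- by solve_with s o.
Qed.

(** [r v] is the frequency of writing [v] as a sum of three elements of [A]. Its mean is the cube of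
    the density, and its mean square counts pairs of triples with equal sums. In characteristic 2
    these are six points of sum 0, that is, translates of the configuration. *)
Lemma mean_sidon_inter (R : realFieldType) (n : nat) (A : {set 'rV['F_2]_n}) :
  density R A ^+ 6 <=
  mean (fun d1 => mean (fun d2 => mean (fun d3 => mean (fun d4 =>
    density R (sidon_inter A d1 d2 d3 d4))))).
Proof.
pose I x : R := (x \in A)%:R.
pose r v := mean (fun p => mean (fun q => I p * (I q * I (v + (p + q))))).
have mr : mean r = density R A ^+ 3.
  rewrite exchange_mean (eq_mean (g := fun p => I p * (mean I * mean I))) => [|p].
    by rewrite mean_mulr /density -/I; ring.
  rewrite exchange_mean (eq_mean (g := fun q => I p * (I q * mean I))) => [|q].
    by rewrite mean_mull mean_mulr.
  by rewrite !mean_mull mean_translate.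
rewrite (_ : 6 = 3 * 2)%N // exprM -mr.
apply: le_trans (sqr_mean_le (0 : 'rV_n) r) _; rewrite le_eqVlt; apply/orP; left; apply/eqP.
pose G p q p' q' v := I p * (I q * I (v + (p + q))) * (I p' * (I q' * I (v + (p' + q')))).
pose f y d1 d2 d3 d4 : R := (y \in sidon_inter A d1 d2 d3 d4)%:R.
transitivity (mean (fun p => mean (fun q => mean (fun p' => mean (fun q' => mean (G p q p' q')))))).
  transitivity (mean (fun v => mean (fun p => mean (fun q => mean (fun p' => mean (fun q' => G p q p' q' v)))))).
    apply: eq_mean => v; rewrite expr2 -mean_mulr; apply: eq_mean => p.
    rewrite -mean_mulr; apply: eq_mean => q; rewrite -mean_mull; apply: eq_mean => p'.
    by rewrite -mean_mull.
  rewrite exchange_mean; apply: eq_mean => p; rewrite exchange_mean; apply: eq_mean => q.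
  by rewrite exchange_mean; apply: eq_mean => p'; rewrite exchange_mean.
transitivity (mean (fun y => mean (fun d1 => mean (fun d2 => mean (fun d3 => mean (f y d1 d2 d3)))))); last first.
  rewrite exchange_mean; apply: eq_mean => d1; rewrite exchange_mean; apply: eq_mean => d2.
  by rewrite exchange_mean; apply: eq_mean => d3; rewrite exchange_mean.
(* Substitute [p = y], [q = y + d1], [p' = y + d2], [q' = y + d3], [v = y + d1 + d4]; the two
   remaining points become [y + d4] and [y + d1 + d2 + d3 + d4]. *)
apply: eq_mean => y; rewrite -(mean_translate _ y); apply: eq_mean => d1.
rewrite -(mean_translate _ y); apply: eq_mean => d2.
rewrite -(mean_translate _ y); apply: eq_mean => d3.
rewrite -(mean_translate _ (y + d1)); apply: eq_mean => d4.
rewrite /G /f /I inE /= addr0 andbT.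
have -> : d4 + (y + d1) + (y + (d1 + y)) = y + d4.
  apply/rowP => i; rewrite !mxE; case: (F2_cases (d4 0 i)) => ->; case: (F2_cases (d1 0 i)) => ->;
  by case: (F2_cases (y 0 i)) => ->; apply/eqP.
have -> : d4 + (y + d1) + (d2 + y + (d3 + y)) = y + (d1 + d2 + d3 + d4).
  apply/rowP => i; rewrite !mxE; case: (F2_cases (d4 0 i)) => ->; case: (F2_cases (d1 0 i)) => ->;
  case: (F2_cases (d2 0 i)) => ->; case: (F2_cases (d3 0 i)) => ->;
  by case: (F2_cases (y 0 i)) => ->; apply/eqP.
rewrite ![_ + y]addrC.
by do 6 (case: (_ \in A); rewrite /= ?(mul0r, mulr0, mul1r, mulr1)).
Qed.

(** The directions are fixed from the outermost average inwards, each outside the span of [B] and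
    the earlier ones, at a cost of [delta] each. The last one avoids a space of dimension
    [k + 3]. *)
Lemma sidon_step (R : realFieldType) (n k : nat) (B : 'M['F_2]_(k, n)) (A : {set 'rV['F_2]_n})
    (delta : R) :
  row_free B -> 2 ^+ k.+3 <= delta * 2 ^+ n -> 4 * delta < density R A ^+ 6 ->
  exists d1 d2 d3 d4,
    row_free (col_mx d1 (col_mx d2 (col_mx d3 (col_mx d4 B)))) /\
    density R A ^+ 6 - 4 * delta <= density R (sidon_inter A d4 d3 d2 d1).
Proof.
move=> fB kn lt_delta.
have delta0 : 0 <= delta.
  by rewrite -(@pmulr_lge0 _ (2 ^+ n)) ?exprn_gt0 // (le_trans _ kn) // exprn_ge0.
have mean01 (f : 'rV['F_2]_n -> R) : (forall d, 0 <= f d <= 1) -> 0 <= mean f <= 1.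
  by move=> f01; rewrite mean_ge0 ?mean_le1 // => d; have /andP[] := f01 d.
have dens01 := density_01 R.
have small j (C : 'M['F_2]_(j, n)) : (j <= k.+3)%N ->
    #|row_space C|%:R <= delta * #|{: 'rV['F_2]_n}|%:R.
  move=> jk; rewrite card_rowF2 natrX; apply: le_trans kn; rewrite -natrX ler_nat.
  apply: leq_trans (card_row_space C) _; rewrite card_Fp //.
  by rewrite leq_exp2l.
have [|||d4 B4 {}le4] := mean_avoid (0 : 'rV_n) _ (mean_sidon_inter R A) (small _ B _).
- by move=> d; do 3 (apply: (mean01 _) => ?); exact: dens01.
- exact: (leq_addl 3 k).
- by lra.
have [|||d3 B3 {}le3] := mean_avoid (0 : 'rV_n) _ le4 (small _ (col_mx d4 B) _).
- by move=> d; do 2 (apply: (mean01 _) => ?); exact: dens01.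
- exact: (leq_addl 2 k.+1).
- by lra.
have [|||d2 B2 {}le2] := mean_avoid (0 : 'rV_n) _ le3 (small _ (col_mx d3 (col_mx d4 B)) _).
- by move=> d; apply: (mean01 _) => ?; exact: dens01.
- exact: (leq_addl 1 k.+2).
- by lra.
have [|||d1 B1 {}le1] := mean_avoid (0 : 'rV_n) _ le2 (small _ (col_mx d2 (col_mx d3 (col_mx d4 B))) _).
- by move=> d; exact: dens01.
- by [].
- by lra.
exists d1, d2, d3, d4; split; first by do 4 (apply: row_free_col_mx => //).
by move: le1; lra.
Qed.

(** The shift [w] may depend on [v], since each [v] only has to be a difference of two elements of
    [S]. The factor 2 absorbs the losses: [2^6 - 4 >= 2]. *)
Lemma F2_difference_chain (R : realFieldType) (n m : nat) (S : {set 'rV['F_2]_n}) (x : R) :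
  0 < x <= 1 -> 2 * x <= density R S -> 2 ^+ (m * 4) <= x ^+ (6 ^ m) * 2 ^+ n ->
  forall k, (k <= m)%N -> exists (B : 'M['F_2]_(k * 4, n)) (A : {set 'rV['F_2]_n}),
    [/\ row_free B,
        {in row_space B, forall v, exists w,
           {in A, forall y, y + w \in S /\ y + w + v \in S}}
      & 2 * x ^+ (6 ^ k) <= density R A].
Proof.
move=> /andP[x0 x1] xS mn; elim=> [_|k IH lt_km].
  exists 0, S; split; [by rewrite /row_free mxrank0| |by rewrite expr1].
  move=> v; rewrite inE => /submxP[u ->]; exists 0 => y yS.
  by rewrite [u]thinmx0 mul0mx !addr0.
have [B [A [fB BA dA]]] := IH (ltnW lt_km).
set z := x ^+ (6 ^ k.+1).
have z0 : 0 < z by rewrite exprn_gt0.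
have zm : x ^+ (6 ^ m) <= z by rewrite ler_wiXn2l ?(ltW x0) // leq_exp2l.
have big : 64 * z <= density R A ^+ 6.
  rewrite /z expnSr exprM (_ : 64 = 2 ^+ 6 :> R) -?exprMn; last by rewrite -natrX.
  have z0' : 0 <= 2 * x ^+ (6 ^ k) by rewrite mulr_ge0 // exprn_ge0 // ltW.
  by rewrite ler_pXn2r ?nnegrE // (le_trans z0').
have [||d1 [d2 [d3 [d4 [fB' dA']]]]] := @sidon_step R n _ B A z fB.
- apply: (@le_trans _ _ (2 ^+ (m * 4))); first by rewrite ler_weXn2l ?ler1n //; lia.
  by apply: le_trans mn _; rewrite ler_pM2r ?exprn_gt0.
- lra.
exists (col_mx d1 (col_mx d2 (col_mx d3 (col_mx d4 B)))), (sidon_inter A d4 d3 d2 d1).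
split => //; last by lra.
move=> v /row_space_col_mxP[a1 [v1 [/row_space_col_mxP[a2 [v2 [+ ->]]] ->]]].
move=> /row_space_col_mxP[a3 [v3 [/row_space_col_mxP[a4 [v4 [v4B ->]]] ->]]].
have [w wP] := BA _ v4B.
(* The induction hypothesis for [v4] is used at [y + q] and at [y + p] with the same [w]; [p - q]
   supplies the rest of [v]. *)
have [p [q [pP qP pq]]] := mem_sidon_translates d4 d3 d2 d1 a4 a3 a2 a1.
exists (w + q) => y; rewrite inE => /allP yP.
have [yq _] := wP _ (yP _ qP); have [_ yp] := wP _ (yP _ pP).
split; first by rewrite [w + q]addrC addrA.
move: yp; rewrite pq; congr (_ \in S); apply/rowP => i; rewrite !mxE; ring.
Qed.

(** * From the iterations to the Ramsey bounds *)

Lemma density_gt0 (R : realFieldType) (T : finType) (A : {set T}) :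
  0 < density R A -> exists y, y \in A.
Proof.
move=> dA; apply/set0Pn; apply: contraTneq dA => ->.
by rewrite densityE cards0 mul0r ltxx.
Qed.

Lemma ramsey_F3 (R : realType) (t n : nat) : (0 < t)%N -> (t <= n)%N ->
  3 ^+ t <= (3 ^- (t + 4)) `^ (C0 R ^+ t) * 3 ^+ n -> ramsey_prop 'F_3 2 t n.
Proof.
move=> t0 tn le_n c.
have [|no_red] := pselect (exists A : 'M['F_3]_(2, n), \rank A = 2 /\ mono_subspace c true A).
  by left.
right; have [//|] := blue_or_dense c R t0 tn.
rewrite card_Fp // => dense.
(* As [81 = 3^4], [81 x] is exactly the guaranteed density [3^-t]. *)
set x : R := 3 ^- (t + 4) in le_n.
have x0 : 0 < x by rewrite invr_gt0 exprn_gt0.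
have x1 : x <= 1 by rewrite invf_le1 ?exprn_gt0 // exprn_ege1 // ler1n.
have xS : 81 * x <= density R (red_set c).
  apply: le_trans dense; rewrite /x exprD invfM mulrCA ler_piMr ?invr_ge0 ?exprn_ge0 //.
  by rewrite ler_pdivrMr; lra.
have [|B [A [fB BA dA]]] := F3_translate_chain _ xS le_n (leqnn t); first by rewrite x0.
have [|y yA] := density_gt0 (lt_le_trans _ dA); first by rewrite mulr_gt0 ?powR_gt0.
exists B; split; first by apply/eqP.
apply: mono_blue => v vB; apply: red_affine_line no_red _; exists y => a.
by apply: BA => //; rewrite inE scalemx_sub //; move: vB; rewrite inE.
Qed.

Lemma ramsey_F2 (m n : nat) : (0 < m)%N -> (m * 4 <= n)%N ->
  (m * 4 + (m * 4).+1 * 6 ^ m <= n)%N -> ramsey_prop 'F_2 2 (m * 4) n.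
Proof.
move=> m0 tn le_n c.
have [|no_red] := pselect (exists A : 'M['F_2]_(2, n), \rank A = 2 /\ mono_subspace c true A).
  by left.
right; have t0 : (0 < m * 4)%N by rewrite muln_gt0 m0.
have [//|] := blue_or_dense c rat t0 tn.
rewrite card_Fp // => dense.
set x : rat := 2 ^- (m * 4).+1.
have x0 : 0 < x by rewrite invr_gt0 exprn_gt0.
have x1 : x <= 1 by rewrite invf_le1 ?exprn_gt0 // exprn_ege1 // ler1n.
have xS : 2 * x <= density rat (red_set c).
  by apply: le_trans dense; rewrite /x exprS invfM mulVKf.
have xn : 2 ^+ (m * 4) <= x ^+ (6 ^ m) * 2 ^+ n.
  rewrite /x exprVn -exprM mulrC ler_pdivlMr ?exprn_gt0 // -exprD.
  by rewrite ler_weXn2l // ler1n.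
have [|B [A [fB BA dA]]] := F2_difference_chain _ xS xn (leqnn m); first by rewrite x0.
have [|y yA] := density_gt0 (lt_le_trans _ dA); first by rewrite mulr_gt0 ?exprn_gt0.
exists B; split; first by apply/eqP.
apply: mono_blue => v vB; apply: red_affine_line no_red _.
have [w wP] := BA v vB; have [yw ywv] := wP _ yA.
by exists (y + w) => a; case: (F2_cases a) => ->; rewrite ?scale0r ?scale1r ?addr0.
Qed.

Lemma ramsey_prop_le (F : finFieldType) (s t u n : nat) :
  (t <= u)%N -> ramsey_prop F s u n -> ramsey_prop F s t n.
Proof.
move=> tu ram c; have [red|[B [rB BC]]] := ram c; [by left | right].
exists ((pid_mx t : 'M[F]_(t, u)) *m B); split.
  by rewrite mxrankMfree ?rank_pid_mx //; apply/eqP.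
by move=> v v0 /submx_trans vB; apply: BC => //; apply: vB; exact: submxMl.
Qed.

Theorem theorem1p5 (R : realType) :
  (exists K : R, exists t0 : nat, 0 < K /\
     forall t : nat, (t0 <= t)%N ->
       ramsey_le 'F_2 2 t (K * t%:R * (6 `^ (t%:R / 4)))) /\
  (exists K : R, exists t0 : nat, 0 < K /\
     forall t : nat, (t0 <= t)%N ->
       ramsey_le 'F_3 2 t (K * t%:R * (C0 R) ^+ t)).
Proof.
split.
  (* [t] is rounded up to a multiple [T] of 4. With [T <= 5t], [T + 1 <= 6t] and [6^m <= 6p], the
     dimension is at most [5t + 36tp <= 41tp]. *)
  exists 41, 1; split=> // t t1.
  pose m := (t %/ 4).+1; pose T := (m * 4)%N.
  have tT : (t <= T)%N by rewrite /T /m; lia.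
  have Tt : (T <= t + 4)%N by rewrite /T /m; lia.
  exists (T + T.+1 * 6 ^ m)%N; split; last first.
    by apply: ramsey_prop_le tT _; apply: ramsey_F2; rewrite // leq_addr.
  set p := 6 `^ (t%:R / 4); have p1 : 1 <= p.
    by rewrite -[leLHS](powRr0 6); apply: ler_powR; rewrite ?divr_ge0 //; lra.
  have le6 : (6 ^ m)%N%:R <= 6 * p.
    rewrite /m expnS natrM ler_pM2l // natrX -powR_mulrn //.
    apply: ler_powR; first lra.
    rewrite ler_pdivlMr // -natrM ler_nat; exact: leq_trunc_div.
  have t1R : 1 <= t%:R :> R by rewrite ler1n.
  have TR : T%:R <= t%:R + 4 :> R by rewrite -natrD ler_nat.
  rewrite natrD natrM -natr1; move: le6 p1 TR t1R (ler0n R (6 ^ m)) (ler0n R T).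
  clearbody p; move: ((6 ^ m)%N%:R) T%:R t%:R => a b s ha hp hb hs a0 b0.
  have h1 : b <= 5 * s by lra.
  have ba : (b + 1) * a <= (6 * s) * (6 * p).
    by apply: ler_pM; lra.
  have : s <= s * p by rewrite ler_peMr //; lra.
  nra.
(* The dimension is at most [t + (t + 4) C0^t + 1], and [1 + 1 + 4 + 1 = 7]. *)
exists 7, 1; split => // t t1.
have C1 : 1 <= C0 R ^+ t by rewrite exprn_ege1 //; have := C0_ge2 R; lra.
have C_ge0 : 0 <= (t + 4)%:R * C0 R ^+ t by rewrite mulr_ge0 // (le_trans ler01).
(* After cancelling [3^t], the hypothesis of [ramsey_F3] asks for [k >= (t + 4) C0^t]. *)
pose k := (Num.truncn ((t + 4)%:R * C0 R ^+ t)).+1.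
have /andP[k1 k2] := Num.Theory.truncn_itv C_ge0.
exists (t + k)%N; split.
  have t1R : 1 <= t%:R :> R by rewrite ler1n.
  rewrite /k natrD -natr1; move: k1; rewrite natrD.
  move: (Num.truncn _)%:R => T; move: t%:R (C0 R ^+ t) t1R C1 => s c s1 c1.
  have : s <= s * c by rewrite ler_peMr //; lra.
  have : c <= s * c by rewrite ler_peMl //; lra.
  nra.
apply: (@ramsey_F3 R) => //; first exact: leq_addr.
rewrite (exprD _ t k) mulrCA ler_pMr ?exprn_gt0 //.
rewrite -(@powR_mulrn _ 3 k) // -(@powR_mulrn _ 3 (t + 4)) // -powRN -powRrM -powRD.
  rewrite -[leLHS](powRr0 3); apply: ler_powR; first lra.
  by rewrite mulNr addrC subr_ge0 ltW.
by rewrite pnatr_eq0 implybT.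
Qed.
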